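(* Let $N\in\mathbb N$, $N\ge1$, and for $\mu=1,2$ let $$\widetilde G_\mu(x,t)=\sum_{j=1}^Ne^{t\alpha_{\mu,j}(x)}\beta_{\mu,j}(x),\qquad x\in\mathbb R^n,\ t\ge0,$$ where $\alpha_{\mu}=(\alpha_{\mu,1},\dots,\alpha_{\mu,N})$ and $\beta_\mu=(\beta_{\mu,1},\dots,\beta_{\mu,N})$ are functions $\mathbb R^n\to\mathbb R^N$ and, for each $\mu$, the coefficients $\alpha_{\mu,1},\dots,\alpha_{\mu,N}$ are all distinct. Assume that the time derivatives of $\widetilde G_1(x,t)$ and $\widetilde G_2(x,t)$ at $t=0$ coincide for all orders $k\in\{0,\dots,2N-1\}$, i.e. $\partial_t^k\widetilde G_1(x,0)=\partial_t^k\widetilde G_2(x,0)$. Then $\widetilde G_1(x,t)=\widetilde G_2(x,t)$.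
   Context: This is the relaxation function of the extended Maxwell model with $N$ spring-dashpot units (the same $N$ for $\mu=1,2$); $\alpha_{\mu,j}=-\tau_{\mu,j}^{-1}$ with $\tau_{\mu,j}$ the relaxation time of the $j$-th unit and $\beta_{\mu,j}$ its spring constant. The equalities in hypothesis and conclusion are between functions of $x\in\mathbb R^n$ (and of $t\ge0$ in the conclusion). *)

(* Defs.v *)
From HB Require Import structures.
From mathcomp Require Import all_boot all_order all_algebra.
From mathcomp Require Import all_classical all_reals all_analysis.

Set Implicit Arguments.
Unset Strict Implicit.
Unset Printing Implicit Defensive.

Import Order.TTheory GRing.Theory Num.Theory.
Import numFieldNormedType.Exports.
Local Open Scope ring_scope.

(* The formula is taken for every real [t], although only [t >= 0] is
   physically relevant.  It is smooth in [t], so that the (two-sided) time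
   derivatives at [t = 0] are those of its restriction to [t >= 0]. *)
Definition relaxation (R : realType) (n N : nat)
    (alpha beta : 'rV[R]_n -> 'rV[R]_N) (x : 'rV[R]_n) (t : R) : R :=
  \sum_(j < N) expR (t * alpha x ord0 j) * beta x ord0 j.

(* Distinctness of the coefficients as functions on [R^n]; they may take the
   same value at some points. *)
Definition distinct_coefficients (R : realType) (n N : nat)
    (alpha : 'rV[R]_n -> 'rV[R]_N) : Prop :=
  forall i j : 'I_N, i <> j ->
    (fun x : 'rV[R]_n => alpha x ord0 i) <> (fun x => alpha x ord0 j).

(* Main.v *)
Require Import Defs.
From HB Require Import structures.
From mathcomp Require Import all_boot all_order all_algebra.
From mathcomp Require Import all_classical all_reals all_analysis.

Set Implicit Arguments.
Unset Strict Implicit.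
Unset Printing Implicit Defensive.

Import Order.TTheory GRing.Theory Num.Theory.
Import numFieldNormedType.Exports.
Local Open Scope ring_scope.

(** Fix [x].  The [k]-th time derivative at [0] is the moment
    [\sum_j alpha_j ^+ k * beta_j], so the hypothesis says that the two discrete
    measures [\sum_j beta_j \delta_(alpha_j)] agree on polynomials of degree
    less than [2 * N].  On the at most [2 * N] points [alpha1_j], [alpha2_j],
    every function, in particular [a |-> expR (t * a)], coincides with such a
    polynomial. *)

(** Newton interpolation, by induction on the nodes. A repeated node needs no new term, so [s] may
    have duplicates and the degree bound still holds. *)
Lemma interpolating_poly (F : fieldType) (f : F -> F) (s : seq F) :
  exists2 p : {poly F}, (size p <= size s)%N & {in s, forall a, p.[a] = f a}.
Proof.
elim: s => [|a s [p szp pE]]; first by exists 0; rewrite ?size_poly0.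
have [as_|aNs] := boolP (a \in s).
  by exists p => [|b]; [exact: leqW|rewrite inE => /predU1P[->|]; exact: pE].
pose q := \prod_(b <- s) ('X - b%:P).
have qa0 : q.[a] != 0 by rewrite -[_ == 0]/(root q a) root_prod_XsubC.
(* The correction vanishes at the old nodes, the roots of [q], and repairs the value at the new node
   [a], where [q] is nonzero. *)
exists (p + ((f a - p.[a]) / q.[a]) *: q) => [|b].
  rewrite (leq_trans (size_polyD _ _))// geq_max leqW//=.
  by rewrite (leq_trans (size_scale_leq _ _))// size_prod_XsubC.
rewrite hornerD hornerZ inE => /predU1P[->|bs].
  by rewrite divfK// addrC subrK.
have /eqP-> : q.[b] == 0 by rewrite -[_ == 0]/(root q b) root_prod_XsubC.
by rewrite mulr0 addr0 pE.
Qed.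

Lemma sum_horner_moments (R : comNzRingType) (N m : nat) (a b : 'I_N -> R)
    (p : {poly R}) : (size p <= m)%N ->
  \sum_j p.[a j] * b j = \sum_(k < m) p`_k * \sum_j a j ^+ k * b j.
Proof.
move=> szp; under [RHS]eq_bigr do rewrite mulr_sumr.
rewrite exchange_big/=; apply: eq_bigr => j _.
by rewrite (horner_coef_wide _ szp) mulr_suml; apply: eq_bigr => k _; rewrite mulrA.
Qed.

(** Interpolating [f] at all [M + N] listed nodes gives a polynomial of size at most [M + N], so
    both sums are the same combination of the first [M + N] moments. Nodes may coincide within a
    family or across the two. *)
Lemma sum_eq_of_moments (F : fieldType) (M N : nat) (a1 b1 : 'I_M -> F)
    (a2 b2 : 'I_N -> F) (f : F -> F) :
  (forall k, (k < M + N)%N ->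
    \sum_j a1 j ^+ k * b1 j = \sum_j a2 j ^+ k * b2 j) ->
  \sum_j f (a1 j) * b1 j = \sum_j f (a2 j) * b2 j.
Proof.
move=> moments.
have [p] := interpolating_poly f (codom a1 ++ codom a2).
rewrite size_cat !size_codom !card_ord => szp pE.
have p1 j : f (a1 j) = p.[a1 j] by rewrite pE// mem_cat codom_f.
have p2 j : f (a2 j) = p.[a2 j] by rewrite pE// mem_cat codom_f orbT.
under eq_bigr do rewrite p1; under [RHS]eq_bigr do rewrite p2.
rewrite !(sum_horner_moments _ _ szp).
by apply: eq_bigr => k _; rewrite moments.
Qed.

(** An equality of functions of [t], not just of values at [0], so that the induction can
    differentiate once more. *)
Lemma derive1n_sum_expR (R : realType) (N : nat) (a b : 'I_N -> R) (k : nat) :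
  derive1n k (fun t => \sum_j expR (t * a j) * b j)
  = fun t => \sum_j expR (t * a j) * (a j ^+ k * b j).
Proof.
elim: k => [|k IH]; apply/funext => t.
  by rewrite derive1n0; apply: eq_bigr => j _; rewrite expr0 mul1r.
rewrite derive1nS IH derive1E.
have term_deriv j : is_derive t 1 (fun u => expR (u * a j) * (a j ^+ k * b j))
    (expR (t * a j) * (a j ^+ k.+1 * b j)).
  (* Instance search applies the product and chain rules; the zero terms removed next are the
     derivatives of the constant factors. *)
  apply: is_derive_eq.
  by rewrite !scaler0 !add0r /GRing.scale/= mulr1 exprS mulrC !mulrA.
have := is_derive_sum term_deriv.
by rewrite fct_sumE => /@derive_val.
Qed.

Theorem theorem1p4 (R : realType) (n N : nat) (hN : (1 <= N)%N)
    (alpha1 beta1 alpha2 beta2 : 'rV[R]_n -> 'rV[R]_N)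
    (halpha1 : distinct_coefficients alpha1)
    (halpha2 : distinct_coefficients alpha2)
    (hderiv : forall k : nat, (k <= 2 * N - 1)%N -> forall x : 'rV[R]_n,
       derive1n k (relaxation alpha1 beta1 x) 0
       = derive1n k (relaxation alpha2 beta2 x) 0) :
  forall (x : 'rV[R]_n) (t : R), 0 <= t ->
    relaxation alpha1 beta1 x t = relaxation alpha2 beta2 x t.
Proof.
move=> x t _.
apply: (sum_eq_of_moments (fun a => expR (t * a))) => k kN.
have derive0 alpha beta : derive1n k (relaxation alpha beta x) 0
    = \sum_j alpha x ord0 j ^+ k * beta x ord0 j.
  rewrite (derive1n_sum_expR (alpha x ord0) (beta x ord0)).
  by under eq_bigr do rewrite mul0r expR0 mul1r.
(* By [hN], the truncated [2 * N - 1] is the true predecessor of [N + N], so [k < N + N] is the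
   bound required by [hderiv]. *)
rewrite -!derive0 hderiv// mul2n -addnn -ltnS subn1 prednK//.
by rewrite (leq_trans hN)// leq_addr.
Qed.
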